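(* Let $G=(V,E)$ be a finite simple graph, let $F\subseteq V$ be a fort of $G$, and let $k=|F|$. Consider the integer program with variables $x_v\in\{0,1\}$ ($v\in V\setminus F$), $y_i\in\{0,1\}$ ($i\in[k]$), $z_{iv}\in\{0,1\}$ ($i\in[k]$, $v\in V$): \[\min\sum_{i\in[k]}y_i\] subject to \[\sum_{v\in V\setminus F}x_v=1,\] \[\sum_{v\in V\setminus F}z_{iv}=y_i\quad\forall i\in[k],\] \[z_{iv}\le x_v\quad\forall i\in[k],\ \forall v\in V\setminus F,\] \[\sum_{i\in[k]}z_{iw}\le\sum_{i\in[k]}y_i-1\quad\forall w\in F,\] \[z_{iw}-z_{iu}+\sum_{a\in N(w)\setminus\{u\}}z_{ia}\ge 0\quad\forall u\in V,\ \forall w\in N(u),\ \forall i\in[k],\] \[z_{iw}\le y_i\quad\forall i\in[k],\ \forall w\in V.\] (i) If this program is infeasible and $F$ is a fort of minimum cardinality, then the inequality $\sum_{v\in F}s_v\ge 1$ defines a facet of the zero forcing polytope of $G$. (ii) If this program has an optimal solution, then the sets $A_i=\{w\in V: z_{iw}=1\}$ for the indices $i$ with $y_i=1$ show that $F$ violates the condition: ''for every $v\notin F$ there is $w\in F$ such that every fort $A\subseteq F\cup\{v\}$ with $v\in A$ contains $w$''; consequently $\sum_{v\in F}s_v\ge1$ does not define a facet of the zero forcing polytope.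
   Context: $N(w)$ denotes the set of neighbors of $w$, and $[k]=\{1,\dots,k\}$. A fort of $G$ is a nonempty set $F\subseteq V$ such that no vertex outside $F$ is adjacent to exactly one vertex in $F$. Zero forcing color change rule: a colored vertex with exactly one uncolored neighbor forces that neighbor to become colored; a zero forcing set is a set $S\subseteq V$ such that starting with exactly $S$ colored and applying the rule repeatedly colors all of $V$. The zero forcing polytope of $G$ is the convex hull in $\mathbb{R}^V$ of the incidence vectors $s\in\{0,1\}^V$ of zero forcing sets of $G$ (equivalently, of the $0/1$ vectors satisfying $\sum_{v\in B}s_v\ge1$ for every fort $B$).
   Formalization: ''Defines a facet'' (face of dimension one less than the polytope) is claimed only for graphs without isolated vertices, as it can fail otherwise; for all graphs the theorem instead states that the face has, in (i), or does not have, in (ii), dimension |V|-1. *)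

(* Defs.v *)
From mathcomp Require Import all_boot all_order all_algebra.
From mathcomp Require Import reals.

Set Implicit Arguments.
Unset Strict Implicit.
Unset Printing Implicit Defensive.

Import Order.TTheory GRing.Theory Num.Theory.
Local Open Scope ring_scope.

Section Graph.
Variables (T : finType) (e : rel T).
Implicit Types (u v w : T) (S A F : {set T}).

Definition nbhd w : {set T} := [set a | e w a].

Definition no_isolated := forall v, exists u, e v u.

Definition fort F :=
  F != set0 /\ forall u, u \notin F -> #|nbhd u :&: F| <> 1%N.

Definition minimum_fort F :=
  fort F /\ forall A, fort A -> (#|F| <= #|A|)%N.

(* One application of the color change rule: [S] is the colored set, and
   [w] forces its only uncolored neighbor [u]. *)
Definition color_step : rel {set T} := fun S S' =>
  [exists w in S, exists u, (nbhd w :\: S == [set u]) && (S' == u |: S)].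

Definition zero_forcing S : bool := connect color_step S [set: T].

Definition common_fort_vertex F :=
  forall v, v \notin F ->
    exists2 w, w \in F &
      forall A, fort A -> A \subset v |: F -> v \in A -> w \in A.

End Graph.

Section Polyhedra.
Variables (R : realType) (E : lmodType R).
Implicit Types (X P : E -> Prop).

Definition convex_hull X : E -> Prop := fun s =>
  exists (n : nat) (p : 'I_n -> E) (c : 'I_n -> R),
    [/\ forall i, X (p i), forall i, 0 <= c i, \sum_i c i = 1
      & s = \sum_i c i *: p i].

Definition affinely_independent n (p : 'I_n -> E) :=
  forall c : 'I_n -> R,
    \sum_i c i = 0 -> \sum_i c i *: p i = 0 -> forall i, c i = 0.

Definition has_affine_family X n :=
  exists2 p : 'I_n -> E, affinely_independent p & forall i, X (p i).

(* [affine_rank X r] means dim X = r - 1, so that dim set0 = -1 has rank 0. *)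
Definition affine_rank X r :=
  has_affine_family X r /\ ~ has_affine_family X r.+1.

Definition face P (f : E -> R) (b : R) : E -> Prop := fun s => P s /\ f s = b.

(* [b <= f s] is valid on [P] and its face has dimension dim P - 1. *)
Definition defines_facet P (f : E -> R) (b : R) :=
  (forall s, P s -> b <= f s) /\
  exists r, affine_rank P r.+1 /\ affine_rank (face P f b) r.

End Polyhedra.

Section Polytope.
Variables (R : realType) (T : finType) (e : rel T).

(* [R^o] is [R] as a module over itself, needed for the module structure on
   {ffun T -> R^o}, i.e. R^V. *)
Definition incidence (S : {set T}) : {ffun T -> R^o} :=
  [ffun v => (v \in S)%:R].

Definition zf_polytope : {ffun T -> R^o} -> Prop :=
  convex_hull (fun s => exists2 S, zero_forcing e S & s = incidence S).

Definition fort_sum (F : {set T}) (s : {ffun T -> R^o}) : R :=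
  \sum_(v in F) s v.

End Polytope.

Arguments zf_polytope R {T} e _.

Section IntegerProgram.
Variables (T : finType) (e : rel T) (F : {set T}).
Let k := #|F|.

Record ip_point := IpPoint {
  ip_x : {v : T | v \notin F} -> bool;
  ip_y : 'I_k -> bool;
  ip_z : 'I_k -> T -> bool }.

(* The 0/1 variables are cast to [int], so that no subtraction is truncated. *)
Definition ip_objective (p : ip_point) : int := \sum_i (ip_y p i)%:Z.

Record ip_feasible (p : ip_point) : Prop := IpFeasible {
  ip_sum_x : \sum_v (ip_x p v)%:Z = 1;
  ip_sum_z : forall i, \sum_(v | v \notin F) (ip_z p i v)%:Z = (ip_y p i)%:Z;
  ip_z_le_x : forall i v, (ip_z p i (val v))%:Z <= (ip_x p v)%:Z;
  ip_avoid : forall w, w \in F ->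
    \sum_i (ip_z p i w)%:Z <= \sum_i (ip_y p i)%:Z - 1;
  ip_fort : forall u w i, w \in nbhd e u ->
    0 <= (ip_z p i w)%:Z - (ip_z p i u)%:Z
         + \sum_(a in nbhd e w :\ u) (ip_z p i a)%:Z;
  ip_z_le_y : forall i w, (ip_z p i w)%:Z <= (ip_y p i)%:Z }.

Definition ip_infeasible := forall p, ~ ip_feasible p.

Definition ip_optimal (p : ip_point) :=
  ip_feasible p /\ forall q, ip_feasible q -> ip_objective p <= ip_objective q.

Definition ip_set (p : ip_point) (i : 'I_k) : {set T} := [set w | ip_z p i w].

(* The sets [ip_set p i] with y_i = 1 refute [common_fort_vertex e F] at some
   single vertex [v]. *)
Definition ip_violation (p : ip_point) :=
  exists2 v, v \notin F &
    (forall i, ip_y p i ->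
       [/\ fort e (ip_set p i), ip_set p i \subset v |: F & v \in ip_set p i])
    /\ (forall w, w \in F -> exists2 i, ip_y p i & w \notin ip_set p i).

End IntegerProgram.

(* Main.v *)
Require Import Defs.
From mathcomp Require Import all_boot all_order all_algebra.
From mathcomp Require Import reals.

(** A set is zero forcing iff it meets every fort, so a zero forcing set S lies
    on the face of F iff it meets F in exactly one vertex w.  If v outside F
    violates the common vertex condition, some fort inside F + v contains v but
    not w, which forces v into S: the face satisfies the second equation
    s_v = 1 and has dimension at most |T| - 2.  If F is minimum and the
    condition holds, the sets (T \ F) + w for w in F and (T \ F) - v + w(v) for
    v outside F are |T| affinely independent zero forcing sets on the face.
    Feasible points of the integer program are exactly the violations. *)

Set Implicit Arguments.
Unset Strict Implicit.
Unset Printing Implicit Defensive.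

Import Order.TTheory GRing.Theory Num.Theory.
Local Open Scope ring_scope.

(** * Forts as the obstructions to zero forcing *)

Section Forts.
Variables (T : finType) (e : rel T).
Implicit Types (u v w : T) (S A F : {set T}).

Lemma disjoint_setU1r A u S :
  [disjoint A & u |: S] = (u \notin A) && [disjoint A & S].
Proof.
by rewrite -!setI_eq0 setIUr setU_eq0 setIC -sub1set setI_eq0 disjoints1 sub1set.
Qed.

(** Makes the common vertex condition decidable, so that its failure yields explicit forts. *)
Definition fortb F :=
  (F != set0) && [forall u, (u \notin F) ==> (#|nbhd e u :&: F| != 1%N)].

Lemma fortP F : reflect (fort e F) (fortb F).
Proof.
apply: (iffP andP) => -[F0 hF]; split=> //.
  by move=> u uF; apply/eqP; move: (forallP hF u); rewrite uF.
by apply/forallP => u; apply/implyP => uF; apply/eqP; apply: hF.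
Qed.

(** If the forced vertex [u] lay in [A], the forcing vertex [w], colored and hence outside [A],
    would have [u] as its only neighbor in [A], because all of [A] is uncolored. *)
Lemma color_step_disjoint_fort A S S' :
  fort e A -> color_step e S S' -> [disjoint A & S] -> [disjoint A & S'].
Proof.
move=> [_ fA] /exists_inP[w wS /existsP[u /andP[/eqP Nu /eqP->]]] dAS.
rewrite disjoint_setU1r dAS andbT.
apply/negP => uA; apply: (fA w).
  by apply/negP => wA; move/disjointFr: dAS => /(_ _ wA); rewrite wS.
suff -> : nbhd e w :&: A = [set u] by rewrite cards1.
apply/eqP; rewrite eqEsubset -Nu; apply/andP; split.
  by apply/subsetP => x; rewrite !inE => /andP[-> /(disjointFr dAS) ->].
apply/subsetP => x xN; move: (xN); rewrite Nu inE => /eqP xu.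
by move: xN; rewrite xu !inE => /andP[_ ->].
Qed.

Lemma zero_forcingP S :
  reflect (forall A, fort e A -> ~~ [disjoint A & S]) (zero_forcing e S).
Proof.
apply: (iffP idP) => [/connectP[p pS lastp] A fA|hS].
  apply/negP => dAS; have [/set0Pn[a aA] _] := fA.
  suff : [disjoint A & last S p].
    by rewrite -lastp => /disjointFr/(_ aA); rewrite inE.
  elim: p S dAS pS {lastp} => //= S' p IHp S dAS /andP[SS' pS'].
  by apply: IHp pS'; apply: color_step_disjoint_fort SS' dAS.
(* Take a largest reachable [S']. Unless it is everything, its complement is a fort: a vertex of
   [S'] with a single neighbor outside [S'] could still force it. *)
have [S' SS' maxS'] := @arg_maxnP _ S (connect (color_step e) S)
                          (fun A => #|A|) (connect0 _ _).
have [S'T|S'T] := eqVneq S' [set: T]; first by rewrite /zero_forcing -S'T.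
have sSS' : S \subset S'.
  case/connectP: SS' => p + ->; elim: p S {hS maxS'} => //= S1 p IHp S.
  move=> /andP[/exists_inP[w _ /existsP[u /andP[_ /eqP->]]] pS1].
  exact: subset_trans (subsetUr _ _) (IHp _ pS1).
have /negP[] : ~~ [disjoint ~: S' & S].
  apply: hS; split.
    by apply: contra S'T => /eqP S'0; rewrite -[S']setCK S'0 setC0.
  move=> w; rewrite inE negbK -setDE => wS' /eqP/cards1P[u Nu].
  have uS' : u \notin S' by have := set11 u; rewrite -Nu inE => /andP[].
  suff /maxS' : connect (color_step e) S (u |: S').
    by rewrite cardsU1 uS' add1n /= ltnn.
  apply: connect_trans SS' _; apply/connect1/exists_inP; exists w => //.
  by apply/existsP; exists u; rewrite Nu !eqxx.
by rewrite disjoint_sym disjoints_subset setCK.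
Qed.

Lemma fort_neq1 v : irreflexive e -> symmetric e -> no_isolated e ->
  ~ fort e [set v].
Proof.
move=> eI eS /(_ v)[u vu] [_ /(_ u)]; apply.
  by rewrite inE; apply: contraTneq vu => ->; rewrite eI.
suff -> : nbhd e u :&: [set v] = [set v] by rewrite cards1.
by apply/setIidPr; rewrite sub1set inE eS.
Qed.

Lemma zero_forcing_setT : zero_forcing e [set: T].
Proof. exact: connect0. Qed.

Lemma zero_forcing_setC1 v : irreflexive e -> symmetric e -> no_isolated e ->
  zero_forcing e [set~ v].
Proof.
move=> eI eS e0; apply/zero_forcingP => A fA.
rewrite disjoints_subset setCK subset1 negb_or; case: (fA) => -> _.
by rewrite andbT; apply/eqP => Av; apply: (@fort_neq1 v eI eS e0); rewrite -Av.
Qed.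

Lemma minimum_fort_eq F A : minimum_fort e F -> fort e A -> A \subset F -> A = F.
Proof. by move=> [_ minF] fA sAF; apply/eqP; rewrite eqEcard sAF minF. Qed.

Lemma zero_forcing_setU1C F w : minimum_fort e F -> w \in F ->
  zero_forcing e (w |: ~: F).
Proof.
move=> mF wF; apply/zero_forcingP => A fA.
rewrite disjoint_setU1r disjoints_subset setCK.
by apply/negP => /andP[wA sAF]; rewrite (minimum_fort_eq mF fA sAF) wF in wA.
Qed.

(** A fort missing this set lies in [v |: F] and avoids [w]. If it contains [v], the hypothesis puts
    [w] in it; otherwise it lies in [F], so it equals [F] by minimality and again contains [w]. *)
Lemma zero_forcing_setU1CD1 F v w :
  minimum_fort e F -> w \in F ->
  (forall A, fort e A -> A \subset v |: F -> v \in A -> w \in A) ->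
  zero_forcing e (w |: (~: F :\ v)).
Proof.
move=> mF wF hw; apply/zero_forcingP => A fA.
rewrite disjoint_setU1r disjoints_subset.
rewrite setCD setCK setUC; apply/negP => /andP[wA sA].
case: (boolP (v \in A)) => [vA|vA]; first by rewrite (hw A) in wA.
move: (wA); rewrite (minimum_fort_eq mF fA) ?wF //.
apply/subsetP => x xA; move/subsetP: sA => /(_ x xA); rewrite !inE.
by case/orP => // /eqP xv; rewrite -xv xA in vA.
Qed.

End Forts.

(** * Affine independence and counting coordinates *)

Section AffineRank.
Variable R : realType.

Lemma leq_card_of_indep (J : finType) m (a : 'I_m -> J -> R) :
  (forall c : 'I_m -> R,
     (forall j, \sum_i c i * a i j = 0) -> forall i, c i = 0) ->
  (m <= #|J|)%N.
Proof.
move=> ha; pose M := \matrix_(i < m, j < #|J|) a i (enum_val j).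
have /eqP <- : row_free M.
  apply: inj_row_free => c cM; apply/rowP => i; rewrite mxE.
  apply: (ha (fun i => c 0 i)) => j.
  move/rowP: cM => /(_ (enum_rank j)); rewrite !mxE => cM0.
  by rewrite -[RHS]cM0; apply: eq_bigr => l _; rewrite mxE enum_rankK.
exact: rank_leq_col.
Qed.

Lemma has_affine_family_card (E : lmodType R) (X : E -> Prop) (J : finType)
    (p : J -> E) :
  (forall j, X (p j)) ->
  (forall c : J -> R,
     \sum_j c j = 0 -> \sum_j c j *: p j = 0 -> forall j, c j = 0) ->
  has_affine_family X #|J|.
Proof.
move=> Xp indep; exists (p \o enum_val) => [c c0 cp0 i|i]; last exact: Xp.
rewrite -(enum_valK i); apply: (indep (c \o enum_rank)).
  rewrite (reindex _ (onW_bij _ (enum_val_bij J))) /= -[RHS]c0.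
  by apply: eq_bigr => j _; rewrite enum_valK.
rewrite (reindex _ (onW_bij _ (enum_val_bij J))) /= -[RHS]cp0.
by apply: eq_bigr => j _; rewrite enum_valK.
Qed.

Lemma has_affine_family_leq (E : lmodType R) (X : E -> Prop) m n :
  (m <= n)%N -> has_affine_family X n -> has_affine_family X m.
Proof.
move=> lemn [p indep Xp]; exists (p \o widen_ord lemn) => [c c0 cp0 i|i]; last exact: Xp.
(* Extend [c] by 0 to the indices from [m] on. *)
pose c' (j : 'I_n) := oapp c 0 (insub (val j)).
have c'E i' : c' (widen_ord lemn i') = c i' by rewrite /c' /= valK.
have sumE (V : lmodType R) (g : 'I_n -> V) :
    \sum_j c' j *: g j = \sum_(j < m) c j *: g (widen_ord lemn j).
  rewrite (bigID (fun j : 'I_n => j < m)%N) /= [X in _ + X]big1 ?addr0.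
    by rewrite (big_ord_narrow lemn); apply: eq_bigr => j _; rewrite c'E.
  by move=> j jm; rewrite /c' insubN ?scale0r.
rewrite -c'E; apply: indep; last by rewrite sumE.
(* The sum of the coefficients is a combination of constant points 1 in [R^o], so [sumE] applies to
   it too. *)
rewrite -[RHS]c0; under eq_bigr do rewrite -[c' _]mulr1.
by rewrite [LHS](sumE R^o (fun=> 1)); apply: eq_bigr => j _; apply: mulr1.
Qed.

Lemma sub_convex_hull (E : lmodType R) (X : E -> Prop) s :
  X s -> convex_hull X s.
Proof.
move=> Xs; exists 1%N, (fun=> s), (fun=> 1).
by split=> //; rewrite big_ord1 ?scale1r.
Qed.

End AffineRank.

(** * Dimensions of the zero forcing polytope and of the face of a fort *)

Section Polytope.
Variables (R : realType) (T : finType) (e : rel T).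
Implicit Types (F S : {set T}) (s : {ffun T -> R^o}).

Lemma sum_scale_ffunE (J : finType) (c : J -> R) (p : J -> {ffun T -> R^o}) v :
  (\sum_j c j *: p j) v = \sum_j c j * p j v.
Proof. by rewrite sum_ffunE; apply: eq_bigr => j _; rewrite ffunE. Qed.

Lemma fort_sum_lin F (J : finType) (c : J -> R) (p : J -> {ffun T -> R^o}) :
  fort_sum F (\sum_j c j *: p j) = \sum_j c j * fort_sum F (p j).
Proof.
rewrite /fort_sum; under eq_bigr do rewrite sum_scale_ffunE.
by rewrite exchange_big; apply: eq_bigr => j _; rewrite mulr_sumr.
Qed.

(** The hyperplane [fort_sum F s = 1] misses the origin, so for points on it a linear dependence is
    already an affine one. This saves one in the dimension bounds for the face. *)
Lemma sum_coef_eq0 F (J : finType) (c : J -> R) (p : J -> {ffun T -> R^o}) :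
  (forall j, fort_sum F (p j) = 1) ->
  (forall v, v \in F -> \sum_j c j * p j v = 0) -> \sum_j c j = 0.
Proof.
move=> p1 cp0; transitivity (fort_sum F (\sum_j c j *: p j)).
  by rewrite fort_sum_lin; apply: eq_bigr => j _; rewrite p1 mulr1.
by rewrite /fort_sum big1 // => v /cp0; rewrite sum_scale_ffunE.
Qed.

Lemma fort_sum_incidence F S : fort_sum F (incidence R S) = #|F :&: S|%:R.
Proof.
rewrite /fort_sum; under eq_bigr do rewrite ffunE.
rewrite -sumr_const big_mkcond [RHS]big_mkcond /=; apply: eq_bigr => v _.
by rewrite inE; case: (v \in F); case: (v \in S).
Qed.

Lemma fort_sum_incidence_ge1 F S : fort e F -> zero_forcing e S ->
  1 <= fort_sum F (incidence R S).
Proof.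
move=> fF /zero_forcingP/(_ _ fF); rewrite -setI_eq0 -card_gt0 => FS.
by rewrite fort_sum_incidence ler1n.
Qed.

Lemma zf_polytope_incidence S :
  zero_forcing e S -> zf_polytope R e (incidence R S).
Proof. by move=> zS; apply: sub_convex_hull; exists S. Qed.

Lemma fort_sum_ge1 F s : fort e F -> zf_polytope R e s -> 1 <= fort_sum F s.
Proof.
move=> fF [n [p [c [zp c0 c1 ->]]]]; rewrite fort_sum_lin -c1.
apply: ler_sum => i _; have [S zS ->] := zp i.
by rewrite ler_peMr // fort_sum_incidence_ge1.
Qed.

Lemma affine_family_le_cardS (X : {ffun T -> R^o} -> Prop) m :
  has_affine_family X m -> (m <= #|T|.+1)%N.
Proof.
move=> [p indep _]; rewrite -card_option.
(* The extra coordinate [None] is constantly 1 and turns affine independence into linear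
   independence. *)
apply: (@leq_card_of_indep R _ _ (fun i => oapp (p i) 1)) => c hc.
apply: indep; first by rewrite -[RHS](hc None); apply: eq_bigr => i _; rewrite mulr1.
by apply/ffunP => v; rewrite sum_scale_ffunE (hc (Some v)) ffunE.
Qed.

Lemma face_affine_family_le_card F m :
  has_affine_family (face (zf_polytope R e) (fort_sum F) 1) m -> (m <= #|T|)%N.
Proof.
move=> [p indep Xp]; apply: (@leq_card_of_indep R _ _ p) => c hc.
have cp0 : \sum_i c i *: p i = 0.
  by apply/ffunP => v; rewrite sum_scale_ffunE hc ffunE.
by apply: indep => //; apply: (@sum_coef_eq0 F _ c p) => [i|v _]; [case: (Xp i)|].
Qed.

(** Every zero forcing set of nonzero weight in [s] meets [F] in a single vertex [w]. It must also
    meet a fort inside [v |: F] that misses [w], and can do so only at [v]. *)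
Lemma face_coord1 F v s : fort e F ->
  (forall w, w \in F ->
     exists2 A, fort e A & [/\ A \subset v |: F, v \in A & w \notin A]) ->
  face (zf_polytope R e) (fort_sum F) 1 s -> s v = 1.
Proof.
move=> fF hv [[n [p [c [zp c0 c1 ->]]]]]; rewrite fort_sum_lin => cF.
(* On the face these weighted slacks sum to 0; being nonnegative, each of them vanishes. *)
have ge0 i : 0 <= c i * (fort_sum F (p i) - 1).
  have [S zS ->] := zp i.
  by rewrite mulr_ge0 // subr_ge0 fort_sum_incidence_ge1.
have /eqP : \sum_i c i * (fort_sum F (p i) - 1) = 0.
  under eq_bigr do rewrite mulrBr mulr1.
  by rewrite sumrB cF c1 subrr.
rewrite psumr_eq0 // => /allP tight.
rewrite sum_scale_ffunE -c1; apply: eq_bigr => i _.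
have := tight i (mem_index_enum i); rewrite /= mulf_eq0 => /orP[/eqP->|].
  by rewrite mul0r.
have [S zS ->] := zp i.
rewrite fort_sum_incidence subr_eq0 pnatr_eq1 => /cards1P[w FSw].
have /andP[wF wS] : (w \in F) && (w \in S) by rewrite -in_setI FSw set11.
have [A fA [sA vA wA]] := hv w wF.
have /pred0Pn[a /andP[/= aA aS]] := zero_forcingP _ _ zS A fA.
have /setU1P[av|aF] := subsetP sA a aA; first by rewrite ffunE -av aS mulr1.
have : a \in F :&: S by rewrite inE aF.
by rewrite FSw inE => /eqP aw; rewrite -aw aA in wA.
Qed.

(** Coordinate [v] is constantly 1 on the face, so a dependence in the other coordinates extends to
    it once the coefficients sum to 0. That sum involves only the coordinates in [F], and [v] is not
    among them. *)
Lemma violated_face_affine_family F v m : fort e F -> v \notin F ->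
  (forall w, w \in F ->
     exists2 A, fort e A & [/\ A \subset v |: F, v \in A & w \notin A]) ->
  has_affine_family (face (zf_polytope R e) (fort_sum F) 1) m -> (m < #|T|)%N.
Proof.
move=> fF vF hv [p indep Xp].
have -> : #|T| = #|{: {u | u != v}}|.+1.
  by rewrite card_sig (cardD1 v) inE add1n; congr _.+1; apply: eq_card => u;
    rewrite !inE andbT.
rewrite ltnS; apply: (@leq_card_of_indep R _ _ (fun i u => p i (val u))) => c hc.
have cp u : u != v -> \sum_i c i * p i u = 0 by move=> uv; apply: (hc (exist _ u uv)).
have c0 : \sum_i c i = 0.
  apply: (@sum_coef_eq0 F _ c p) => [i|u uF]; first by case: (Xp i).
  by apply: cp; apply: contraNneq vF => <-.
apply: indep => //; apply/ffunP => u; rewrite sum_scale_ffunE ffunE.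
have [->|/cp//] := eqVneq u v; rewrite -[RHS]c0.
by apply: eq_bigr => i _; rewrite (face_coord1 fF hv (Xp i)) mulr1.
Qed.

Lemma zf_polytope_affine_rank :
  irreflexive e -> symmetric e -> no_isolated e ->
  affine_rank (zf_polytope R e) #|T|.+1.
Proof.
move=> eI eS e0; split; last by move/affine_family_le_cardS; rewrite ltnn.
rewrite -card_option.
(* The affinely independent points are the whole vertex set and the complements of single vertices.
   Coordinate [v] sums all coefficients except that of [[set~ v]], which is therefore 0. *)
pose q o := incidence R (oapp (fun v : T => [set~ v]) setT o).
apply: (@has_affine_family_card _ _ _ _ q) => [[v|]|c c0 cq].
- exact/zf_polytope_incidence/zero_forcing_setC1.
- exact/zf_polytope_incidence/zero_forcing_setT.
have cS v : c (Some v) = 0.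
  have : (\sum_o c o *: q o) v = 0 by rewrite cq ffunE.
  rewrite sum_scale_ffunE (bigD1 (Some v)) //= ffunE !inE eqxx mulr0 add0r.
  under eq_bigr => o ov.
    have -> : q o v = 1.
      rewrite ffunE; case: o ov => [u|_] /=; last by rewrite inE.
      by rewrite !inE eq_sym => /negPf uv; rewrite -(inj_eq Some_inj) uv.
    rewrite mulr1; over.
  by move=> cv; move: c0; rewrite (bigD1 (Some v)) //= cv addr0.
case=> // ; move: c0; rewrite (bigD1 None) //= big1 ?addr0 // => -[v|] //.
Qed.

Lemma face_affine_rank F : minimum_fort e F -> common_fort_vertex e F ->
  affine_rank (face (zf_polytope R e) (fort_sum F) 1) #|T|.
Proof.
move=> mF cF; split; last by move/face_affine_family_le_card; rewrite ltnn.
have [g gF gA] : exists2 g : T -> T, forall v, g v \in F &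
    forall v A, v \notin F ->
      fort e A -> A \subset v |: F -> v \in A -> g v \in A.
  apply: (@fin_all_exists2 T (fun=> T) (fun _ w => w \in F)
    (fun v w => forall A, v \notin F ->
      fort e A -> A \subset v |: F -> v \in A -> w \in A)) => v.
  (* Inside [F] the value of [g] is a mere placeholder, as [S] uses [g] only outside [F]. *)
  have [vF|vF] := boolP (v \in F); first by exists v.
  by have [w wF hw] := cF v vF; exists w => // A _; apply: hw.
pose S u := if u \in F then u |: ~: F else g u |: (~: F :\ u).
have zS u : zero_forcing e (S u).
  rewrite /S; have [uF|uF] := ifPn; first exact: zero_forcing_setU1C.
  by apply: zero_forcing_setU1CD1 => // A; apply: gA.
have FS u : F :&: S u = [set if u \in F then u else g u].
  apply/setP => x; rewrite /S; have := gF u; case: ifP => uF gu; rewrite !inE.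
    by have [->|xu] := eqVneq x u; rewrite ?uF // andbN.
  by have [->|xu] := eqVneq x (g u); rewrite ?gu //=; case: (x \in F); rewrite ?andbF.
apply: (@has_affine_family_card _ _ _ _ (fun u => incidence R (S u))).
  move=> u; split; first exact: zf_polytope_incidence.
  by rewrite fort_sum_incidence FS cards1.
move=> c c0 cS.
have cSv v : \sum_u c u * (v \in S u)%:R = 0.
  have : (\sum_u c u *: incidence R (S u)) v = 0 by rewrite cS ffunE.
  by rewrite sum_scale_ffunE; under eq_bigr do rewrite ffunE.
(* Among the sets [S u], only [S v] omits such a [v], so coordinate [v] sums all coefficients but
   [c v]. *)
have cN v : v \notin F -> c v = 0.
  move=> vF; have := cSv v; rewrite (bigD1 v) //=.
  have -> : v \in S v = false.
    rewrite /S (negPf vF) !inE eqxx orbF; apply/negP => /eqP vg.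
    by rewrite vg gF in vF.
  rewrite mulr0 add0r => cv; move: c0; rewrite (bigD1 v) //=.
  suff -> : \sum_(u | u != v) c u = 0 by rewrite addr0.
  rewrite -[RHS]cv; apply: eq_bigr => u uv.
  suff -> : v \in S u by rewrite mulr1.
  by rewrite /S; case: ifP => _; rewrite !inE vF ?andbT 1?[v == u]eq_sym ?uv orbT.
move=> w; have [wF|/cN//] := boolP (w \in F).
(* Only coefficients of [u] in [F] survive, and then [S u] contains [w] only if [u] is [w]. *)
have := cSv w; rewrite (bigD1 w) //= big1 => [|u uw].
  by rewrite addr0 /S wF setU11 mulr1.
have [uF|/cN->] := boolP (u \in F); last by rewrite mul0r.
by rewrite /S uF !inE wF orbF eq_sym (negPf uw) mulr0.
Qed.

End Polytope.

(** * Feasible points as violations of the common vertex condition *)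

Section IntegerProgram.
Variables (T : finType) (e : rel T) (F : {set T}).

Lemma ip_infeasible_common_fort_vertex :
  symmetric e -> ip_infeasible e F -> common_fort_vertex e F.
Proof.
move=> eS noip v vF.
pose good A w := [&& fortb e A, A \subset v |: F, v \in A & w \notin A].
have [/exists_inP[w wF /forallP wA]|] :=
    boolP [exists w in F, [forall A, ~~ good A w]].
  exists w => // A /fortP fA sA vA; move: (wA A).
  by rewrite /good fA sA vA negbK.
rewrite negb_exists_in => /forall_inP hA; exfalso.
(* Index [i] stands for the [i]-th vertex of [F], and [A i] is a fort through [v] that avoids it;
   this is why [#|F|] indices suffice. *)
have /fin_all_exists[A hgood] i : exists A, good A (enum_val (A := F) i).
  have := hA _ (enum_valP i).
  by rewrite negb_forall => /existsP[A]; rewrite negbK; exists A.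
have fA i : fort e (A i) by have /and4P[/fortP] := hgood i.
have vA i : v \in A i by have /and4P[] := hgood i.
have Av i u : u \notin F -> u \in A i = (u == v).
  move=> uF; have /and4P[_ /subsetP/(_ u) sA _ _] := hgood i.
  have [->|uv] := eqVneq u v; first exact: vA.
  by apply/negP => /sA; rewrite !inE (negPf uv) (negPf uF).
apply: (noip (IpPoint (fun u => val u == v) (fun=> true) (fun i u => u \in A i))).
split=> /=.
- rewrite (bigD1 (exist _ v vF)) //= eqxx big1 ?addr0 // => u uv.
  by rewrite (_ : val u == v = false) //; apply: contraNF uv => /eqP uv;
    apply/eqP/val_inj.
- move=> i; rewrite (bigD1 v) //= vA big1 ?addr0 // => u /andP[uF uv].
  by rewrite Av // (negPf uv).
- by move=> i u; rewrite Av ?(valP u).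
(* The fort chosen for [w] itself contributes 0, which accounts for the [- 1]. *)
- move=> w wF; rewrite (bigD1 (enum_rank_in wF w)) //=.
  have /and4P[_ _ _] := hgood (enum_rank_in wF w).
  rewrite enum_rankK_in // => /negPf ->; rewrite add0r.
  rewrite [leRHS](_ : _ = \sum_(i | i != enum_rank_in wF w) 1).
    by apply: ler_sum => i _; case: (w \in A i).
  by rewrite (bigD1 (enum_rank_in wF w)) //= addrAC subrr add0r.
- move=> u w i; rewrite inE => uw.
  have sum0 : 0 <= \sum_(a in nbhd e w :\ u) (a \in A i)%:Z by apply: sumr_ge0.
  have [uA|uA] := boolP (u \in A i); last by rewrite subr0 addr_ge0.
  have [wA|wA] := boolP (w \in A i); first by rewrite subrr add0r.
  (* Here [w] lies outside the fort and has the neighbor [u] in it, hence a second neighbor [a] in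
     it. *)
  rewrite sub0r addrC subr_ge0.
  have [a aN] : exists a, a \in (nbhd e w :&: A i) :\ u.
    apply/set0Pn; rewrite -card_gt0; have [_ /(_ w wA)/eqP] := fA i.
    by rewrite (cardsD1 u) !inE eS uw uA /= add1n eqSS -lt0n.
  move: aN; rewrite !inE => /and3P[au wa aA].
  by rewrite (bigD1 a) ?inE ?au //= aA lerDl sumr_ge0.
- by move=> i w; case: (w \in A i).
Qed.

Lemma ip_feasible_violation p :
  symmetric e -> ip_feasible e p -> ip_violation (F := F) e p.
Proof.
move=> eS [sx sz zx av hf zy].
have [[v vF] /= xv xuniq] : exists2 v, ip_x p v & forall u, ip_x p u -> u = v.
  have [v xv|x0] := pickP (ip_x p); last first.
    by move: sx; rewrite big1 // => u _; rewrite x0.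
  exists v => // u xu; apply/eqP/negPn/negP => uv.
  move: sx; rewrite (bigD1 v) //= (bigD1 u) //= xv xu => sx.
  have : 0 <= \sum_(i | (i != v) && (i != u)) (ip_x p i)%:Z by apply: sumr_ge0.
  by move: sx; case: (\sum_(i | _) _) => //= -[].
have zout i u : u \notin F -> ip_z p i u -> u = v.
  move=> uF zu; have := zx i (exist _ u uF); rewrite /= zu => xu.
  have /xuniq/(congr1 val) // : ip_x p (exist _ u uF) by move: xu; case: ip_x.
exists v => //; split=> [i yi|w wF].
  have zv : ip_z p i v.
    have := sz i; rewrite yi (bigD1 v) //= big1 => [|u /andP[uF uv]].
      by case: ip_z.
    by case zu: ip_z => //; rewrite (zout i u) ?eqxx // in uv.
  split; last by rewrite inE.
    split; first by apply/set0Pn; exists v; rewrite inE.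
    (* If [u] were the only neighbor of [w] in the set, the sum over the other neighbors would
       vanish and the fort constraint would read [0 <= -1]. *)
    move=> w; rewrite inE => zw /eqP/cards1P[u Nu].
    have /andP[wu zu] : (w \in nbhd e u) && ip_z p i u.
      have : u \in nbhd e w :&: ip_set p i by rewrite Nu set11.
      by rewrite !inE eS.
    have := hf u w i wu; rewrite (negPf zw) zu big1 // => a.
    rewrite !inE => /andP[au wa]; case za: ip_z => //.
    have : a \in nbhd e w :&: ip_set p i by rewrite !inE wa za.
    by rewrite Nu inE (negPf au).
  apply/subsetP => u; rewrite !inE => zu; have [|uF] := boolP (u \in F).
    by rewrite orbT.
  by rewrite (zout i u) ?eqxx.
have [i /andP[yi zi]|none] := pickP (fun i => ip_y p i && ~~ ip_z p i w).
  by exists i => //; rewrite inE.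
(* If every active set contained [w], then [z] and [y] would agree at [w] for all indices, and a
   number would be at most itself minus 1. *)
have := av w wF; rewrite (eq_bigr (fun i => (ip_y p i)%:Z)) => [|i _].
  by rewrite lerBrDr gerDl.
by have := zy i w; have := none i; case: ip_y; case: ip_z.
Qed.

End IntegerProgram.

(** An isolated vertex is a fort by itself and lies in every zero forcing set, so the polytope is
    full-dimensional only without such vertices. The dimension of the face is therefore stated
    separately from the facet property. *)
Theorem theorem9 (R : realType) (T : finType) (e : rel T) (F : {set T}) :
  symmetric e -> irreflexive e -> fort e F ->
  (ip_infeasible e F -> minimum_fort e F ->
     affine_rank (face (zf_polytope R e) (fort_sum F) 1%R) #|T|
     /\ (no_isolated e -> defines_facet (zf_polytope R e) (fort_sum F) 1%R))
  /\
  (forall p : ip_point F, ip_optimal e p ->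
     [/\ ip_violation e p,
         ~ common_fort_vertex e F,
         ~ affine_rank (face (zf_polytope R e) (fort_sum F) 1%R) #|T|
       & no_isolated e -> ~ defines_facet (zf_polytope R e) (fort_sum F) 1%R]).
Proof.
move=> eS eI fF; split=> [noip mF|p [feas _]].
  have rk := face_affine_rank R mF (ip_infeasible_common_fort_vertex eS noip).
  split=> // e0; split=> [s|]; first exact: fort_sum_ge1.
  by exists #|T|; split=> //; apply: zf_polytope_affine_rank.
have viol := ip_feasible_violation eS feas.
have [v vF [hA hw]] := viol.
have nofam : ~ has_affine_family (face (zf_polytope R e) (fort_sum F) 1) #|T|.
  move=> fam; suff : (#|T| < #|T|)%N by rewrite ltnn.
  apply: (violated_face_affine_family fF vF _ fam) => w /hw[i yi wi].
  by exists (ip_set p i); have [] := hA i yi.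
split=> //; [|by case|].
  move=> /(_ v vF)[w /hw[i /hA[fi si vi] /negP wi] /(_ _ fi si vi)]; exact: wi.
(* The polytope has rank [#|T|.+1], so a facet would have [r] at least [#|T|] and would contain
   [#|T|] affinely independent points. *)
move=> e0 [_ [r [[_ nor] [famr _]]]]; apply: nofam.
apply: has_affine_family_leq famr; rewrite leqNgt; apply/negP => rT.
apply: nor; have [famT _] := zf_polytope_affine_rank R eI eS e0.
exact: has_affine_family_leq famT.
Qed.
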